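(* Let $\mathcal{H}$ be a Hilbert space and let $\varphi$ be a bounded finite potent endomorphism of $\mathcal{H}$ with $i(\varphi)\leq 1$. Then the Moore-Penrose inverse $\varphi^{\dagger}$ is also a bounded finite potent endomorphism of $\mathcal{H}$, and $i(\varphi^{\dagger})\leq 1$.
   Context: An endomorphism $\varphi$ of a vector space $V$ is finite potent if $\varphi^n(V)$ is finite-dimensional for some $n$. Equivalently, there is a (unique) $\varphi$-invariant decomposition $V=W_\varphi\oplus U_\varphi$ (AST-decomposition) with $\varphi|_{U_\varphi}$ nilpotent, $W_\varphi$ finite-dimensional and $\varphi|_{W_\varphi}$ an automorphism of $W_\varphi$. The index $i(\varphi)$ is the nilpotency order of $\varphi|_{U_\varphi}$; $i(\varphi)\le 1$ iff $W_\varphi=\operatorname{Im}(\varphi)$ iff $U_\varphi=\operatorname{Ker}(\varphi)$. A bounded finite potent $\varphi$ with $i(\varphi)\le1$ has finite-dimensional (hence closed) image, so $\mathcal{H}=\operatorname{Ker}(\varphi)\oplus[\operatorname{Ker}(\varphi)]^\perp=\operatorname{Im}(\varphi)\oplus[\operatorname{Im}(\varphi)]^\perp$, and its Moore-Penrose inverse $\varphi^\dagger$ exists: it is the unique linear map with $\varphi\varphi^\dagger\varphi=\varphi$, $\varphi^\dagger\varphi\varphi^\dagger=\varphi^\dagger$ and both $\varphi^\dagger\varphi$ and $\varphi\varphi^\dagger$ self-adjoint. *)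

(* Defs.v *)
From HB Require Import structures.
From mathcomp Require Import all_boot all_order all_algebra sesquilinear.
From mathcomp Require Import complex.
From mathcomp Require Import all_classical all_reals all_analysis.

Set Implicit Arguments.
Unset Strict Implicit.
Unset Printing Implicit Defensive.

Import Order.TTheory GRing.Theory Num.Theory.
Import numFieldNormedType.Exports.

Local Open Scope classical_set_scope.
Local Open Scope complex_scope.
Local Open Scope ring_scope.

(* Scalars of a Hilbert space: the real numbers with the trivial conjugation,
   or the complex numbers with complex conjugation. *)
Inductive real_or_complex : forall K : numFieldType, (K -> K) -> Prop :=
| real_scalars (R : realType) : @real_or_complex R idfun
| complex_scalars (R : realType) : @real_or_complex R[i] Num.conj.

Section FinitePotent.
Variables (K : fieldType) (V : lmodType K).
Implicit Types (A W U : set V) (f : {linear V -> V}).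

(* A has a finite spanning family; for a linear subspace A this is
   finite-dimensionality. *)
Definition finite_dimensional A :=
  exists (n : nat) (e : 'I_n -> V),
    A = [set x | exists c : 'I_n -> K, x = \sum_(i < n) c i *: e i].

Definition finite_potent f :=
  exists n : nat, finite_dimensional (range (iter n f)).

Definition direct_decomposition W U :=
  [/\ submod_closed (mem W), submod_closed (mem U),
      W `&` U = [set 0]
    & forall x, exists w u, [/\ W w, U u & x = w + u]].

Definition nilpotent_on f U (n : nat) := forall u, U u -> iter n f u = 0.

Definition AST_decomposition f W U :=
  [/\ direct_decomposition W U,
      f @` W `<=` W /\ f @` U `<=` U,
      exists n, nilpotent_on f U n,
      finite_dimensional W
    & set_bij W W f].

(* The nilpotency order of f on U is the least n >= 0 with f^n = 0 on U; in
   particular it is 0 when U = 0. *)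
Definition has_index f (n : nat) :=
  exists W U,
    [/\ AST_decomposition f W U, nilpotent_on f U n
      & forall m, nilpotent_on f U m -> (n <= m)%N].

End FinitePotent.

Definition bounded_operator (K : numFieldType) (V : normedModType K)
    (f : {linear V -> V}) :=
  exists M : K, forall x, `|f x| <= M * `|x|.

Section MoorePenrose.
Variables (K : numFieldType) (conj : K -> K) (V : lmodType K).
Variable dot : {dot V for conj}.

Definition self_adjoint (f : V -> V) := forall x y, dot (f x) y = dot x (f y).

Definition moore_penrose_inverse (f g : {linear V -> V}) :=
  [/\ f \o g \o f =1 f, g \o f \o g =1 g,
      self_adjoint (g \o f) & self_adjoint (f \o g)].

End MoorePenrose.

(* Main.v *)
(* For y in H there is exactly one z orthogonal to Ker phi such that y - phi z
   is orthogonal to Im phi, and the Moore-Penrose inverse maps y to z. To obtain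
   z, project y onto the finite-dimensional space Im phi and take the preimage of
   smallest norm, which exists by completeness and continuity of phi. The inverse
   factors through the projection y |-> sum_i <y, v_i> / <v_i, v_i> v_i onto
   Im phi, so it is bounded with finite-dimensional range. Its range (Ker phi)^_|_
   meets its kernel (Im phi)^_|_ trivially because H = Im phi + Ker phi, whence
   its index is at most 1. *)
Require Import Defs.
From HB Require Import structures.
From mathcomp Require Import all_boot all_order all_algebra sesquilinear.
From mathcomp Require Import complex ring.
From mathcomp Require Import all_classical all_reals all_analysis.

Set Implicit Arguments.
Unset Strict Implicit.
Unset Printing Implicit Defensive.

Import Order.TTheory GRing.Theory Num.Theory.
Import numFieldNormedType.Exports.

Local Open Scope classical_set_scope.
Local Open Scope ring_scope.

(** * Conjugation and infima for real or complex scalars *)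

Section Scalars.
Variables (K : numFieldType) (conj : K -> K).

Lemma conj_normK (scalars : real_or_complex conj) c : c * conj c = `|c| ^+ 2.
Proof.
case: scalars c => R c; last by rewrite normCK.
by rewrite real_normK ?num_real.
Qed.

(** In the complex case nonnegative scalars are real, so the infimum of the real parts serves. *)
Lemma nonneg_inf (scalars : real_or_complex conj) (A : set K) :
    A !=set0 -> (forall a, A a -> 0 <= a) ->
  exists d, (forall a, A a -> d <= a) /\
    forall e, 0 < e -> exists2 a, A a & a < d + e.
Proof.
case: scalars A => R A [a0 Aa0] A0.
  have infA : has_inf A by split; [exists a0 | exists 0 => a /A0].
  exists (inf A); split=> [a Aa|e e0]; last exact: inf_adherent.
  by apply: ge_inf => //; case: infA.
pose B := [set complex.Re a | a in A].
have infB : has_inf B.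
  split; first by exists (complex.Re a0), a0.
  by exists 0 => _ [a /A0 + <-]; rewrite lecE => /andP[].
exists (inf B)%:C%C; split=> [a Aa|e].
  rewrite lecE /=; have := A0 _ Aa; rewrite lecE /= => /andP[-> _] /=.
  by apply: ge_inf; [case: infB|exists a].
rewrite ltcE /= => /andP[/eqP ei e0].
have [_ [a Aa <-] lt_a] := inf_adherent e0 infB.
exists a => //; rewrite ltcE /=; case: e ei e0 lt_a => er ei /= -> _ lt_a.
have := A0 _ Aa; rewrite lecE /= => /andP[/eqP-> _].
by rewrite addr0 eqxx.
Qed.

End Scalars.

(** * Finite-dimensional subspaces and the index *)

Section FiniteDimensional.
Variables (K : fieldType) (V : lmodType K).

(** Ranks of successive powers cannot drop forever, and equal ranks reverse the inclusion of the row
    space of [M ^+ k.+1] in that of [M ^+ k]. *)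
Lemma rank_expmx_stable n (M : 'M[K]_n) :
  exists k, (M ^+ k <= M ^+ k.+1)%MS.
Proof.
suff [k rk] : exists k, (\rank (M ^+ k) <= \rank (M ^+ k.+1))%N.
  exists k; have sub : (M ^+ k.+1 <= M ^+ k)%MS by rewrite exprS submxMl.
  by rewrite -(geq_leqif (mxrank_leqif_sup sub)).
apply/not_existsP => noeq.
have dec k : (\rank (M ^+ k) + k <= \rank (M ^+ 0))%N.
  elim: k => [|k IHk]; first by rewrite addn0.
  apply: leq_trans IHk; rewrite addnS -addSn leq_add2r.
  by rewrite ltnNge; apply/negP/noeq.
by have := dec (\rank (M ^+ 0)).+1; rewrite leqNgt addnS ltnS leq_addl.
Qed.

(** The spanning family may be dependent, so the matrix [M] of [f] need not be invertible.
    Stabilisation gives [M ^+ k = D *m M ^+ k.+1], so [E v] and [f (E (v *m D))] agree after [k]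
    applications of [f], which injectivity cancels. *)
Lemma finite_dimensional_inj_surj (f : {linear V -> V}) (A : set V) :
    finite_dimensional A -> f @` A `<=` A ->
    (forall x, A x -> f x = 0 -> x = 0) ->
  forall x, A x -> exists2 y, A y & f y = x.
Proof.
move=> [n [e defA]] fA injf.
pose E (v : 'rV[K]_n) := \sum_i v 0 i *: e i.
have AE v : A (E v) by rewrite defA; exists (v 0).
have EA x : A x -> exists v, x = E v.
  rewrite defA => -[c ->]; exists (\row_i c i).
  by apply: eq_bigr => i _; rewrite mxE.
have Ee i : e i = E (delta_mx 0 i).
  rewrite /E (bigD1 i) //= mxE !eqxx scale1r big1 ?addr0 // => j ji.
  by rewrite mxE (negPf ji) scale0r.
have /choice[r fe] : forall i, exists v, f (e i) = E v.
  by move=> i; apply: EA; apply: fA; exists (e i) => //; rewrite Ee.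
pose M := \matrix_i r i.
have fE v : f (E v) = E (v *m M).
  rewrite /E linear_sum.
  under eq_bigr => i _ do rewrite linearZ /= fe /E scaler_sumr.
  rewrite exchange_big /=; apply: eq_bigr => j _.
  rewrite mxE scaler_suml; apply: eq_bigr => i _.
  by rewrite !mxE scalerA.
have iterE k v : iter k f (E v) = E (v *m M ^+ k).
  elim: k v => [|k IHk] v; first by rewrite mulmx1.
  by rewrite iterSr fE IHk exprS mulmxA.
have EB u v : E (u - v) = E u - E v.
  by rewrite /E -sumrB; apply: eq_bigr => i _; rewrite !mxE scalerBl.
have injE k v : iter k f (E v) = 0 -> E v = 0.
  by elim: k v => //= k IHk v; rewrite iterE => /injf-/(_ (AE _)); rewrite -iterE => /IHk.
have [k /submxP[D defD]] := rank_expmx_stable M.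
move=> _ /EA[v ->]; exists (E (v *m D)) => //.
apply/eqP; rewrite eq_sym -subr_eq0 fE -EB; apply/eqP.
apply: (injE k); rewrite iterE mulmxBl {1}defD.
by rewrite exprS -[M * _]/(M *m _) !mulmxA subrr /E big1 // => i _; rewrite mxE scale0r.
Qed.

(** With index at most 1, [f] kills [U], which forces [W] to be the range of [f]. *)
Lemma has_index_le1 (f : {linear V -> V}) n : has_index f n -> (n <= 1)%N ->
  finite_dimensional (range f) /\
  forall x, exists a u, x = f a + u /\ f u = 0.
Proof.
move=> [W [U [[[_ _ _ dec] _ _ finW [fW _ Wf]] nilU _]]] n1.
have fU u : U u -> f u = 0.
  move=> /nilU; case: n n1 {nilU} => [_ /= ->|[|//] _ //].
  exact: linear0.
have WE : W = range f.
  apply/seteqP; split=> [x /Wf[y _ <-]|_ [x _ <-]]; first by exists y.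
  have [w [u [Ww /fU fu0 ->]]] := dec x.
  by rewrite linearD fu0 addr0; apply: fW.
split=> [|x]; first by rewrite -WE.
have [w [u [Ww /fU fu0 ->]]] := dec x.
by move: Ww; rewrite WE => -[a _ <-]; exists a, u.
Qed.

(** The second hypothesis makes [f] injective, hence bijective, on its range, so range and kernel
    form an AST-decomposition. *)
Lemma has_index_le1_of_range (f : {linear V -> V}) :
    finite_dimensional (range f) -> (forall x, f (f x) = 0 -> f x = 0) ->
  exists2 n, has_index f n & (n <= 1)%N.
Proof.
move=> finf injf.
have surjf x : exists y, f (f y) = f x.
  have sub_range : f @` range f `<=` range f by move=> _ [y _ <-]; exists y.
  have inj_range z : range f z -> f z = 0 -> z = 0.
    by move=> [y _ <-]; apply: injf.
  have fx : range f (f x) by exists x.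
  have [_ [y _ <-] fy] := finite_dimensional_inj_surj finf sub_range inj_range fx.
  by exists y.
pose U := [set u | f u = 0].
have ast : AST_decomposition f (range f) U.
  split=> //.
  - split.
    + split=> [|c _ _ /set_mem[x _ <-] /set_mem[y _ <-]]; apply/mem_set.
        by exists 0 => //; rewrite linear0.
      by exists (c *: x + y) => //; rewrite linearP.
    + split=> [|c x y /set_mem/= fx /set_mem/= fy]; apply/mem_set => /=.
        by rewrite /U /= linear0.
      by rewrite /U /= linearP fx fy scaler0 addr0.
    + apply/seteqP; split=> [_ [[x _ <-] /injf]//|_ ->]; split; rewrite /U /= ?linear0 //.
      by exists 0 => //; rewrite linear0.
    + move=> x; have [y fy] := surjf x.
      exists (f y), (x - f y); split; first by exists y.
        by rewrite /U /= linearB fy subrr.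
      by rewrite addrC subrK.
  - split=> _ [x + <-]; first by move=> _; exists x.
    by move=> /= ->; rewrite /U /= linear0.
  - by exists 1%N.
  - split.
    + by move=> _ [x _ <-]; exists (f x).
    + move=> x y /set_mem[a _ <-] /set_mem[b _ <-] /eqP.
      by rewrite -subr_eq0 -!linearB => /eqP/injf/eqP; rewrite linearB subr_eq0 => /eqP.
    + by move=> _ [x _ <-]; have [y <-] := surjf x; exists (f y) => //; exists y.
(* A trivial kernel gives index 0, any other kernel index 1. *)
have [U0|U0] := pselect (nilpotent_on f U 0).
  by exists 0%N => //; exists (range f), U.
exists 1%N => //; exists (range f), U; split=> // -[|m] //.
Qed.

End FiniteDimensional.

(** * Inner products, Gram-Schmidt and least squares *)

Section Dot.
Variables (K : numFieldType) (conj : K -> K) (V : lmodType K).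
Variable dot : {dot V for conj}.

Lemma dot_conj x y : dot y x = conj (dot x y).
Proof. by rewrite (@hermitian_subproof _ _ _ _ dot y x) expr0 mul1r. Qed.

Lemma dot_eq0C x y : dot x y = 0 -> dot y x = 0.
Proof.
move=> xy0; have conj0 : conj 0 = 0.
  by rewrite -(linear0l dot 0) -dot_conj.
by rewrite dot_conj xy0.
Qed.

Lemma dot_self_eq0 x : dot x x = 0 -> x = 0.
Proof.
move=> xx0; apply/eqP; apply: contraT => /neq0_dnorm_gt0.
by move=> /(_ conj dot); rewrite xx0 ltxx.
Qed.

Lemma dot_self_ge0 x : 0 <= dot x x.
Proof.
have [->|/neq0_dnorm_gt0 x0] := eqVneq x 0; first by rewrite linear0l.
exact/ltW/x0.
Qed.

(** For orthogonal [t] this is the orthogonal projection of [x] onto the span of [t]. *)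
Definition gram_schmidt_sum (t : seq V) (x : V) :=
  \sum_(v <- t) (dot x v / dot v v) *: v.

(* A null vector in the family is harmless, as both its coefficient (a division
   by 0) and its contribution vanish. *)
Lemma gram_schmidt (s : seq V) : exists t : seq V,
  (forall A : set V, A 0 -> (forall c x y, A x -> A y -> A (c *: x + y)) ->
     {in s, forall b, A b} -> {in t, forall v, A v}) /\
  forall x, {in s, forall b, dot (x - gram_schmidt_sum t x) b = 0}.
Proof.
elim: s => [|b s [t [tA orth]]]; first by exists [::].
pose v := b - gram_schmidt_sum t b.
have sum_closed (A : set V) : A 0 -> (forall c x y, A x -> A y -> A (c *: x + y)) ->
    {in s, forall b, A b} -> forall x, A (gram_schmidt_sum t x).
  move=> A0 Alin sA x; have := tA A A0 Alin sA.
  rewrite /gram_schmidt_sum.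
  elim: t {tA orth v} => [|u t IHt] ttA; first by rewrite big_nil.
  rewrite big_cons; apply: Alin; first by apply: ttA; rewrite mem_head.
  by apply: IHt => w wt; apply: ttA; rewrite inE wt orbT.
exists (v :: t); split=> [A A0 Alin sA|x c].
  have {}sA : {in s, forall b, A b} /\ A b.
    by split=> [c cs|]; apply: sA; rewrite inE ?cs ?orbT ?eqxx.
  move=> u; rewrite inE => /predU1P[->|]; last exact: tA sA.1 _.
  rewrite /v -scaleN1r addrC; apply: (Alin _ _ _ _ sA.2).
  exact: sum_closed sA.1 _.
have orth_sum y z : {in s, forall b, dot z b = 0} -> dot z (gram_schmidt_sum t y) = 0.
  (* Quantifying over subspaces [A] encodes the span of [s]; here [A] is the orthogonal complement
     of [z]. *)
  move=> zs; apply: (sum_closed [set w | dot z w = 0]) => //= [|k u w zu zw].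
    by rewrite linear0r.
  by rewrite linearDr linearZr_LR /= zu zw mulr0 addr0.
have vs : {in s, forall b, dot v b = 0} := orth b.
have bE : b = v + gram_schmidt_sum t b by rewrite subrK.
clearbody v; rewrite /gram_schmidt_sum big_cons -/(gram_schmidt_sum t x).
rewrite [_ *: v + _]addrC opprD addrA linearBl linearZl_LR /=.
rewrite inE => /predU1P[->|cs]; last by rewrite (orth x c cs) (vs c cs) mulr0 subrr.
rewrite bE !linearDr /= !orth_sum ?addr0; try exact: orth; try exact: vs.
rewrite linearBl /= (dot_eq0C (orth_sum x v vs)) subr0.
have [vv0|vv0] := eqVneq (dot v v) 0; last by rewrite mulr0 addr0 divfK ?subrr.
by rewrite (dot_self_eq0 vv0) !(linear0r, mulr0, addr0, subrr).
Qed.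

(** Pythagoras: the residual is orthogonal to [k]. For [k = 0] the division by 0 makes both sides
    [dot x x]. *)
Lemma dot_sub_proj x k :
  dot (x - (dot x k / dot k k) *: k) (x - (dot x k / dot k k) *: k) =
  dot x x - dot x k * conj (dot x k) / dot k k.
Proof.
set t := _ / _.
have orth : dot (x - t *: k) k = 0.
  rewrite linearBl linearZl_LR /= /t.
  have [/dot_self_eq0->|kk0] := eqVneq (dot k k) 0; last by rewrite divfK ?subrr.
  by rewrite !(linear0r, mulr0, subrr).
rewrite linearBr linearZr_LR /= orth mulr0 subr0 linearBl linearZl_LR /=.
by rewrite -dot_conj /t mulrAC.
Qed.

(* z is the least-squares solution of f z = y of minimal norm. *)
Definition least_squares (f : {linear V -> V}) (y z : V) :=
  (forall k, f k = 0 -> dot z k = 0) /\ forall x, dot (y - f z) (f x) = 0.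

(** [f (z1 - z2)] is in the range and orthogonal to it, hence 0; then [z1 - z2] is in the kernel and
    orthogonal to it. *)
Lemma least_squares_unique (f : {linear V -> V}) y z1 z2 :
  least_squares f y z1 -> least_squares f y z2 -> z1 = z2.
Proof.
move=> [k1 r1] [k2 r2].
have fz : f (z1 - z2) = 0.
  apply: dot_self_eq0; rewrite {1}linearB.
  have -> : f z1 - f z2 = (y - f z2) - (y - f z1).
    by rewrite opprB [RHS]addrC addrA subrK.
  by rewrite linearBl /= r1 r2 subrr.
apply/eqP; rewrite -subr_eq0; apply/eqP/dot_self_eq0.
by rewrite linearBl /= k1 // k2 // subrr.
Qed.

Lemma least_squares_linear (f : {linear V -> V}) c y1 y2 z1 z2 :
  least_squares f y1 z1 -> least_squares f y2 z2 ->
  least_squares f (c *: y1 + y2) (c *: z1 + z2).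
Proof.
move=> [k1 r1] [k2 r2]; split=> [k fk0|x].
  by rewrite linearPl /= k1 // k2 // mulr0 addr0.
rewrite linearP opprD addrACA -scalerBr linearPl /= r1 r2.
by rewrite mulr0 addr0.
Qed.

Lemma least_squares0 (f : {linear V -> V}) y :
  (forall x, dot y (f x) = 0) -> least_squares f y 0.
Proof.
by move=> fy; split=> [k _|x]; [exact: linear0l|rewrite linear0 subr0].
Qed.

(** Both sides say that [f \o g] projects orthogonally onto the range of [f], and that [g] takes
    values orthogonal to its kernel. *)
Lemma least_squares_moore_penrose (f g : {linear V -> V}) :
  (forall y, least_squares f y (g y)) <-> moore_penrose_inverse dot f g.
Proof.
split=> [ls|[fgf gfg sgf sfg] y]; last first.
  split=> [k fk0|x].
    by rewrite -gfg /= (sgf (g y) k) /= fk0 linear0 linear0r.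
  rewrite -(fgf x) /= -(sfg (y - f (g y)) (f x)) /=.
  by rewrite !linearB /= -[f (g (f (g y)))]/((f \o g \o f) (g y)) fgf subrr linear0l.
have fgf : f \o g \o f =1 f.
  move=> x /=; apply/eqP; rewrite eq_sym -subr_eq0; apply/eqP/dot_self_eq0.
  by rewrite -{2}linearB (ls (f x)).2.
split=> //.
- move=> y /=; apply: least_squares_unique (ls _) _.
  by split=> [k|x]; [apply: (ls y).1 | rewrite subrr linear0l].
(* [y - g (f y)] is in the kernel, hence orthogonal to [g (f x)]; the new right-hand side is
   Hermitian in [x] and [y]. *)
- have symgf x y : dot (g (f x)) y = dot (g (f x)) (g (f y)).
    apply/eqP; rewrite -subr_eq0 -linearBr; apply/eqP/(ls (f x)).1.
    by rewrite linearB -[f (g (f y))]/((f \o g \o f) y) fgf subrr.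
  by move=> x y /=; rewrite symgf [RHS]dot_conj (symgf y x) -dot_conj.
- have symfg x y : dot x (f (g y)) = dot (f (g x)) (f (g y)).
    by apply/eqP; rewrite -subr_eq0 -linearBl; apply/eqP/(ls x).2.
  by move=> x y /=; rewrite [RHS]symfg [LHS]dot_conj (symfg y x) -dot_conj.
Qed.

End Dot.

(** * Minimal-norm preimages and projection in a Hilbert space *)

Section Hilbert.
Variables (K : numFieldType) (conj : K -> K).
Hypothesis scalars : real_or_complex conj.
Variables (H : completeNormedModType K) (dot : {dot H for conj}).
Hypothesis dot_norm : forall x : H, dot x x = `|x| ^+ 2.

(** A sharp Cauchy-Schwarz: [dot x k] is small when removing the component along [k] barely shortens
    [x]. *)
Lemma dot_sub_proj_norm x k :
  `|dot x k| ^+ 2 = (`|x| ^+ 2 - `|x - (dot x k / dot k k) *: k| ^+ 2) * `|k| ^+ 2.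
Proof.
rewrite -!dot_norm dot_sub_proj (conj_normK scalars).
have [/dot_self_eq0->|kk0] := eqVneq (dot k k) 0.
  by rewrite !(linear0r, normr0, expr0n, mulr0).
by rewrite subKr divfK.
Qed.

Lemma cauchy_schwarz x y : `|dot x y| <= `|x| * `|y|.
Proof.
rewrite -(@ler_pXn2r _ 2) ?nnegrE ?mulr_ge0 //.
rewrite dot_sub_proj_norm exprMn ler_wpM2r ?exprn_ge0 //.
by rewrite lerBlDr lerDl exprn_ge0.
Qed.

Lemma parallelogram (x y : H) :
  `|x - y| ^+ 2 = 2 * `|x| ^+ 2 + 2 * `|y| ^+ 2 - `|x + y| ^+ 2.
Proof.
rewrite -!dot_norm !linearBl !linearBr !linearDl !linearDr /=; ring.
Qed.

Lemma bounded_operator_pos (f : {linear H -> H}) :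
  bounded_operator f -> exists2 M, 0 < M & forall x, `|f x| <= M * `|x|.
Proof.
(* On the zero space the given [M] may be any scalar, even a negative one. *)
move=> [M fM]; exists (`|M| + 1) => [|x]; first by rewrite ltr_pwDr.
have [->|x0] := eqVneq x 0; first by rewrite linear0 normr0 mulr0.
have M0 : 0 <= M.
  have /(le_trans (normr_ge0 _)) := fM x.
  by rewrite pmulr_lge0 // normr_gt0.
by apply: le_trans (fM x) _; rewrite ler_wpM2r // ger0_norm // lerDl.
Qed.

(* The preimages of y whose norm is almost minimal form a Cauchy filter by the
   parallelogram identity, and its limit is the preimage of minimal norm. *)
Lemma preimage_orth_ker (f : {linear H -> H}) (x0 : H) : bounded_operator f ->
  exists x, f x = f x0 /\ forall k, f k = 0 -> dot x k = 0.
Proof.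
move=> /bounded_operator_pos[M M0 fM].
pose D := [set x | f x = f x0].
have [d [d_le d_inf]] : exists d, (forall x, D x -> d <= `|x| ^+ 2) /\
    forall e, 0 < e -> exists2 x, D x & `|x| ^+ 2 < d + e.
  have [||d [dle dinf]] := nonneg_inf scalars (A := [set `|x| ^+ 2 | x in D]).
  - by exists (`|x0| ^+ 2), x0.
  - by move=> _ [x _ <-]; rewrite exprn_ge0.
  exists d; split=> [x Dx|e /dinf[_ [x Dx <-]]]; last by exists x.
  by apply: dle; exists x.
pose B e := [set x | D x /\ `|x| ^+ 2 < d + e].
pose F := filter_from [set e : K | 0 < e] B.
have FF : ProperFilter F.
  apply: filter_from_proper; last by move=> e /d_inf[x]; exists x.
  apply: filter_from_filter; first by exists 1 => /=.
  move=> e1 e2 /= e10 e20.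
  have [le12|le21] : e1 <= e2 \/ e2 <= e1.
    by apply/orP/real_leVge; apply: gtr0_real.
  - exists e1 => // x [Dx xe]; do 2![split=> //].
    by apply: lt_le_trans xe _; rewrite lerD2l.
  - exists e2 => // x [Dx xe]; do 2![split=> //].
    by apply: lt_le_trans xe _; rewrite lerD2l.
have small e x y : B e x -> B e y -> `|x - y| ^+ 2 < 4 * e.
  move=> [Dx xe] [Dy ye].
  (* The midpoint of [x] and [y] is again a preimage, so the parallelogram identity bounds their
     distance. *)
  have : d <= `|2^-1 *: (x + y)| ^+ 2.
    apply: d_le; rewrite /D /= linearZ linearD /= Dx Dy -[_ + _]mulr2n.
    by rewrite -[f x0 *+ 2]scaler_nat scalerA mulVf ?scale1r ?pnatr_eq0.
  rewrite normrZ exprMn normfV normr_nat exprVn ler_pdivlMl ?exprn_gt0 // => xyd.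
  have -> : 4 * e = 2 * (d + e) + 2 * (d + e) - 2 ^+ 2 * d by ring.
  by rewrite parallelogram ltr_leD ?lerN2 // ltrD // ltr_pM2l.
have cF : cauchy F.
  apply/cauchy_ballP => e e0.
  exists (B (e ^+ 2 / 4), B (e ^+ 2 / 4)) => [|[a b] /= [Ba Bb]].
    by split; exists (e ^+ 2 / 4) => //=; rewrite divr_gt0 ?exprn_gt0.
  rewrite -ball_normE /ball_ /= -(@ltr_pXn2r _ 2) ?nnegrE ?normr_ge0 ?(ltW e0) //.
  by apply: lt_le_trans (small _ _ _ Ba Bb) _; rewrite mulrC divfK ?pnatr_eq0.
have /cvg_ex[x Fx] : cvg F by exact: cauchy_cvg cF.
have near_x e n : 0 < e -> 0 < n -> exists2 y, B n y & `|x - y| < e.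
  move=> e0 n0.
  have /fcvgrPdist_lt/(_ e e0) Fe := Fx.
  have Bn : F (B n) by exists n.
  by have [y [yB ye]] := filter_ex (filterI Bn Fe); exists y.
have eps0 (N : K) : 0 <= N -> (forall e, 0 < e -> N <= e) -> N = 0.
  rewrite le0r => /predU1P[//|N0] /(_ (N / 2)).
  by rewrite divr_gt0 // ler_pMr // invf_ge1 // (ler_nat _ 2 1) => /(_ isT).
exists x; split=> [|k fk0].
  apply/eqP; rewrite -subr_eq0 -normr_eq0; apply/eqP/eps0 => // e e0.
  have [y [Dy _] ye] := near_x (e / M) 1 (divr_gt0 e0 M0) ltr01.
  rewrite -Dy -linearB; apply: le_trans (fM _) _.
  by rewrite mulrC -ler_pdivlMr // ltW.
apply/eqP; rewrite -normr_eq0; apply/eqP/eps0 => // e e0.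
(* Adding 1 keeps [c] nonzero when [k = 0]. With this [h], the terms [dot (x - y) k] and [dot y k]
   each get half of [e]. *)
pose c := `|k| + 1; have c0 : 0 < c by rewrite ltr_pwDr.
have kc : `|k| <= c by rewrite lerDl.
pose h := e / (2 * c); have h0 : 0 < h by rewrite divr_gt0 ?mulr_gt0.
have [y [Dy yd] xy] := near_x h (h ^+ 2) h0 (exprn_gt0 2 h0).
have -> : e = h * c + h * c.
  by rewrite -mulr2n -mulr_natl mulrCA /h divfK // gt_eqF ?mulr_gt0.
rewrite -(subrK y x) linearDl; apply: le_trans (ler_normD _ _) (lerD _ _) => /=.
  by apply: le_trans (cauchy_schwarz _ _) _; rewrite ler_pM // ltW.
(* Subtracting a multiple of [k] from [y] stays in [D], so the squared norm drops by at most
   [h ^+ 2]. *)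
rewrite -(@ler_pXn2r _ 2) ?nnegrE ?normr_ge0 ?(ltW (mulr_gt0 h0 c0)) //.
rewrite dot_sub_proj_norm exprMn ler_pM ?exprn_ge0 ?ler_pXn2r ?nnegrE //;
  rewrite ?normr_ge0 ?(ltW c0) //; last first.
  rewrite lerBlDr addrC (le_trans (ltW yd)) // lerD2r d_le //.
  by rewrite /D /= linearB linearZ /= fk0 scaler0 subr0.
by rewrite subr_ge0 -!dot_norm dot_sub_proj (conj_normK scalars) lerBlDr
  lerDl divr_ge0 ?exprn_ge0 ?dot_self_ge0.
Qed.

(** Gram-Schmidt on a spanning family of the range, which, being a subspace, contains the resulting
    [t]. *)
Lemma range_orth_proj (f : {linear H -> H}) : finite_dimensional (range f) ->
  exists2 t : seq H, {in t, forall v, range f v} &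
    forall x y, dot (y - gram_schmidt_sum dot t y) (f x) = 0.
Proof.
move=> [n [e fe]].
have [t [tA orth]] := gram_schmidt dot [seq e i | i <- enum 'I_n].
exists t => [|x y].
  apply: tA => [|c _ _ [x _ <-] [y _ <-]|_ /mapP[i _ ->]].
  - by exists 0 => //; rewrite linear0.
  - by exists (c *: x + y) => //; rewrite linearP.
  - rewrite fe; exists (fun j => (i == j)%:R).
    rewrite (bigD1 i) //= eqxx scale1r big1 ?addr0 // => j.
    by rewrite eq_sym => /negPf->; rewrite scale0r.
have : range f (f x) by exists x.
rewrite fe => -[c ->]; rewrite linear_sumr big1 // => i _.
rewrite linearZr_LR /= orth ?mulr0 //.
by apply: map_f; rewrite mem_enum.
Qed.

Lemma exists_least_squares (f : {linear H -> H}) y :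
    bounded_operator f -> finite_dimensional (range f) ->
  exists z, least_squares dot f y z.
Proof.
move=> bf /range_orth_proj[t tf orth].
have [x _ fx] : range f (gram_schmidt_sum dot t y).
  rewrite /gram_schmidt_sum big_seq; elim/big_ind: _ => [|_ _ [a _ <-] [b _ <-]|v /tf[a _ <-]].
  - by exists 0 => //; rewrite linear0.
  - by exists (a + b) => //; rewrite linearD.
  - by eexists; [|exact: linearZ].
have [z [fz zk]] := preimage_orth_ker x bf.
by exists z; split=> // a; rewrite fz fx.
Qed.

End Hilbert.

(** * The inverse as the least-squares solution map *)

Theorem proposition3p3 (K : numFieldType) (conj : K -> K)
    (scalars : real_or_complex conj)
    (H : completeNormedModType K) (dot : {dot H for conj})
    (dot_norm : forall x : H, dot x x = `|x| ^+ 2)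
    (phi : {linear H -> H})
    (phi_bounded : bounded_operator phi)
    (phi_finite_potent : finite_potent phi)
    (phi_index : exists2 n, has_index phi n & (n <= 1)%N) :
  exists phi_dag : {linear H -> H},
    [/\ moore_penrose_inverse dot phi phi_dag,
        forall psi : {linear H -> H},
          moore_penrose_inverse dot phi psi -> psi =1 phi_dag,
        bounded_operator phi_dag,
        finite_potent phi_dag
      & exists2 n, has_index phi_dag n & (n <= 1)%N].
Proof.
have [n phi_n n1] := phi_index.
have [fin_phi ker_im] := has_index_le1 phi_n n1.
have /choice[g0 ls0] y := exists_least_squares scalars dot_norm y phi_bounded fin_phi.
have g0_lin : linear g0.
  by move=> c x y; apply: least_squares_unique (ls0 _) (least_squares_linear _ _ _).
pose g : {linear H -> H} :=
  HB.pack g0 (GRing.isLinear.Build K H H *:%R g0 g0_lin).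
have ls y : least_squares dot phi y (g y) := ls0 y.
clearbody g.
have [t tf orth] := range_orth_proj dot fin_phi.
have gE y : g y = \sum_(v <- t) (dot y v / dot v v) *: g v.
  (* The residual of [y] is orthogonal to the range of [phi], so its least-squares solution is 0. *)
  have -> : g y = g (gram_schmidt_sum dot t y).
    apply/eqP; rewrite -subr_eq0 -linearB; apply/eqP.
    exact: least_squares_unique (ls _) (least_squares0 (orth ^~ y)).
  by rewrite /gram_schmidt_sum linear_sum; apply: eq_bigr => v _; rewrite linearZ.
have fin_g : finite_dimensional (range g).
  exists (size t), (fun i => g t`_i); apply/seteqP.
  split=> [_ [y _ <-]|_ [c ->]].
    by rewrite gE (big_nth 0) big_mkord; eexists; reflexivity.
  exists (\sum_(i < size t) c i *: t`_i) => //.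
  by rewrite linear_sum; apply: eq_bigr => i _; rewrite linearZ.
exists g; split.
- exact/least_squares_moore_penrose.
- move=> psi /least_squares_moore_penrose ls_psi y.
  exact: least_squares_unique (ls_psi y) (ls y).
- exists (\sum_(v <- t) `|v| / `|dot v v| * `|g v|) => y.
  rewrite gE mulr_suml; apply: le_trans (ler_norm_sum _ _ _) _.
  apply: ler_sum => v _; rewrite normrZ normf_div.
  rewrite [leRHS]mulrAC ler_wpM2r // [leRHS]mulrAC ler_wpM2r ?invr_ge0 // [leRHS]mulrC.
  apply: (cauchy_schwarz scalars dot_norm).
- by exists 1%N.
- apply: has_index_le1_of_range fin_g _ => x gg0.
  (* [g x] is orthogonal to the kernel of [phi] and, since [g (g x) = 0], also to its range; these
     two span the space. *)
  have [a [u [gxE u0]]] := ker_im (g x).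
  apply: (@dot_self_eq0 _ _ _ dot); rewrite [in X in dot _ X]gxE linearDr /=.
  by rewrite ((ls x).1 u u0) addr0; have := (ls (g x)).2 a; rewrite gg0 linear0 subr0.
Qed.
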